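(* Assume that $f(\varepsilon,\cdot)\in C^2[0,1)$. Let $v$ be a solution of $v'(t)=Mv(t)+g(\varepsilon,v(t))$ with components in $[0,1)$, and put $t_{k+1}=t_k+\tau_k$, $v_k=v(t_k)$, $v_{k+1}=v(t_{k+1})$. Then for every $\theta\in[0,1]$, as $\tau_k\to0^+$, $$\int_{t_k}^{t_{k+1}}E((t_{k+1}-s)M)\,g(\varepsilon,v(s))\,ds-M^{-1}[E(\tau_kM)-I]\,[\theta g(\varepsilon,v_k)+(1-\theta)g(\varepsilon,v_{k+1})]=O(\tau_k^p),$$ where $p=2$ when $\theta=1/2$, and $p=1$ otherwise.
   Context: Mesh: $\mathcal{D}=(-1,1)\times(-1,1)$, $a,b>0$, $N_x,N_y$ are (large) positive integers, $-1=x_0<x_1<\dots<x_{N_x+1}=1$, $-1=y_0<\dots<y_{N_y+1}=1$, $h_{x,i}=x_{i+1}-x_i>0$ ($0\le i\le N_x$), $h_{y,j}=y_{j+1}-y_j>0$ ($0\le j\le N_y$). The degeneracy function $\sigma:\overline{\mathcal{D}}\to[0,\infty)$ vanishes only on a subset of $\partial\mathcal{D}$; $\sigma_{i,j}=\sigma(x_i,y_j)$. Interior grid vectors $v=(v_{1,1},v_{2,1},\dots,v_{N_x,1},v_{1,2},\dots,v_{N_x,N_y})^{T}\in\mathbb{R}^{N_xN_y}$ are ordered lexicographically. Matrices: $B=\mathrm{diag}(\sigma_{1,1}^{-1},\sigma_{2,1}^{-1},\dots,\sigma_{N_x,N_y}^{-1})$ (same ordering); for $\alpha\in\{x,y\}$,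 $T_\alpha\in\mathbb{R}^{N_\alpha\times N_\alpha}$ is tridiagonal with $(T_\alpha)_{i,i}=-\frac{2}{h_{\alpha,i-1}h_{\alpha,i}}$, $(T_\alpha)_{i,i+1}=\frac{2}{h_{\alpha,i}(h_{\alpha,i-1}+h_{\alpha,i})}$, $(T_\alpha)_{i+1,i}=\frac{2}{h_{\alpha,i}(h_{\alpha,i}+h_{\alpha,i+1})}$; $M=a^{-2}B(I_{N_y}\otimes T_x)+b^{-2}B(T_y\otimes I_{N_x})$. $E(A)=e^{A}$ is the matrix exponential. The mesh, and hence $M$, is fixed as $\tau_k\to0^+$, and so are $t_k$ and the solution $v$. Reaction term: $\varepsilon=\varepsilon(x,y)$ is a bounded stochastic influence (fixed in time). For each value of $\varepsilon$, $f(\varepsilon,\cdot)$ is a function on $[0,1)$ with $f(\varepsilon,0)>0$, $f_u(\varepsilon,u)>0$, $\lim_{u\to1^-}f(\varepsilon,u)=\infty$, $\int_0^1 f(\varepsilon,u)\,du=\infty$. For $v\in[0,1)^{N_xN_y}$, $g(\varepsilon,v)$ is the vector with components $f(\varepsilon(x_i,y_j),v_{i,j})/\sigma_{i,j}$. *)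

(* Defs.v *)
From HB Require Import structures.
From mathcomp Require Import all_boot all_order all_algebra.
From mathcomp Require Import mxtens.
From mathcomp Require Import all_classical all_reals all_analysis.

Set Implicit Arguments.
Unset Strict Implicit.
Unset Printing Implicit Defensive.

Import Order.TTheory GRing.Theory Num.Theory.
Import numFieldNormedType.Exports.

Local Open Scope classical_set_scope.
Local Open Scope ring_scope.

Section Calculus.
Context {R : realType}.

(* Derivative relative to A: two-sided at interior points of A and one-sided
   at an endpoint of A belonging to A.  As with the library's derive1, the
   value is meaningful only under derivable_within. *)
Definition derivable_within {V : normedModType R} (A : set R) (f : R -> V)
    (x : R) : Prop :=
  cvg ((y - x)^-1 *: (f y - f x) @[y --> within A x^']).

Definition derive_within {V : normedModType R} (A : set R) (f : R -> V)
    (x : R) : V :=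
  lim ((y - x)^-1 *: (f y - f x) @[y --> within A x^']).

Definition C2_within (A : set R) (f : R -> R) : Prop :=
  [/\ forall x, A x -> derivable_within A f x,
      forall x, A x -> derivable_within A (derive_within A f) x
    & {within A, continuous (derive_within A (derive_within A f))}].

Definition expmx {n : nat} (A : 'M[R]_n) : 'M[R]_n :=
  limn (series (fun k : nat => (k`!%:R)^-1 *: A ^+ k)).

Definition integral_cV {n : nat} (a b : R) (F : R -> 'cV[R]_n) : 'cV[R]_n :=
  \col_k \int[lebesgue_measure]_(s in `[a, b]) F s k ord0.

Definition is_ode_solution {n : nat} (I : interval R) (A : 'M[R]_n)
    (G : 'cV[R]_n -> 'cV[R]_n) (v : R -> 'cV[R]_n) : Prop :=
  forall t, t \in I ->
    derivable_within [set` I] v t /\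
    derive_within [set` I] v t = A *m v t + G (v t).

End Calculus.

Section Semidiscretization.
Context {R : realType}.

Definition domD : set (R * R) := [set p | -1 < p.1 < 1 /\ -1 < p.2 < 1].

Definition degeneracy (sigma : R * R -> R) : Prop :=
  (forall p, closure domD p -> 0 <= sigma p) /\
  (forall p, closure domD p -> sigma p = 0 ->
     (closure domD `\` interior domD) p).

(* Nodes z_0 < ... < z_(N+1); the values z i for i > N+1 are never used. *)
Definition is_mesh (N : nat) (z : nat -> R) : Prop :=
  [/\ z 0 = -1, z N.+1 = 1 & forall i : nat, (i <= N)%N -> z i < z i.+1].

Definition mesh_step (z : nat -> R) (i : nat) : R := z i.+1 - z i.

(* Here p and q are the 1-based row and column indices. *)
Definition T_entry (h : nat -> R) (p q : nat) : R :=
  if q == p then - (2 / (h p.-1 * h p))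
  else if q == p.+1 then 2 / (h p * (h p.-1 + h p))
  else if p == q.+1 then 2 / (h q * (h q + h q.+1))
  else 0.

Definition T_mx (N : nat) (z : nat -> R) : 'M[R]_N :=
  \matrix_(i < N, j < N) T_entry (mesh_step z) i.+1 j.+1.

(* Lexicographic ordering with the x-index running fastest: coordinate
   k = j * Nx + i of a grid vector belongs to the node (x_(i+1), y_(j+1)),
   consistently with the Kronecker product *t of mxtens. *)
Definition node (Nx Ny : nat) (x y : nat -> R) (k : 'I_(Ny * Nx)) : R * R :=
  let ji := mxtens_unindex k in (x ji.2.+1, y ji.1.+1).

Definition B_mx (Nx Ny : nat) (x y : nat -> R) (sigma : R * R -> R) :
    'M[R]_(Ny * Nx) :=
  diag_mx (\row_k (sigma (node x y k))^-1).

Definition M_mx (Nx Ny : nat) (a b : R) (x y : nat -> R)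
    (sigma : R * R -> R) : 'M[R]_(Ny * Nx) :=
  a ^- 2 *: (B_mx Nx Ny x y sigma *m ((1%:M : 'M[R]_Ny) *t T_mx Nx x)) +
  b ^- 2 *: (B_mx Nx Ny x y sigma *m (T_mx Ny y *t (1%:M : 'M[R]_Nx))).

(* The admissibility conditions on one function f(e, .); those on the
   derivative are read on [0, 1[, one-sidedly at 0. *)
Definition reaction_term (fe : R -> R) : Prop :=
  [/\ 0 < fe 0,
      forall u, u \in `[0, 1[ ->
        derivable_within `[0, 1[ fe u /\ 0 < derive_within `[0, 1[ fe u,
      fe u @[u --> 1^'-] --> +oo
    & (\int[lebesgue_measure]_(u in `[0%R, 1%R[) (fe u)%:E = +oo)%E].

Definition g_vec (Nx Ny : nat) (x y : nat -> R) (sigma eps : R * R -> R)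
    (f : R -> R -> R) (w : 'cV[R]_(Ny * Nx)) : 'cV[R]_(Ny * Nx) :=
  \col_k (f (eps (node x y k)) (w k ord0) / sigma (node x y k)).

End Semidiscretization.

(* Main.v *)
Require Import Defs.
From HB Require Import structures.
From mathcomp Require Import all_boot all_order all_algebra.
From mathcomp Require Import mxtens.
From mathcomp Require Import all_classical all_reals all_analysis.
From mathcomp Require Import measurable_realfun.
From mathcomp Require Import zify ring lra.

Set Implicit Arguments.
Unset Strict Implicit.
Unset Printing Implicit Defensive.

Import Order.TTheory GRing.Theory Num.Theory.
Import numFieldNormedType.Exports.

Local Open Scope classical_set_scope.
Local Open Scope ring_scope.

(** Both terms of the difference agree with tau * g(v_k) up to O(tau^2), for
every theta; since tau^2 <= tau for small tau, this yields both exponents.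

Write G(s) = g(v(s)).  A function with a derivative at a point is calm there:
its increments are at most a constant times the increment of the argument
(derivable_within_calm).  Calmness passes through composition and through
coordinates, so |G(s) - G(t_k)| <= L (s - t_k) for s slightly to the right of
t_k.  The power series gives E(r M) = I + r M + O(r^2) (expmxZ_taylor).

Hence the integrand E((t_k + tau - s) M) G(s) is G(t_k) + O(tau) uniformly on
[t_k, t_k + tau], and its integral is tau G(t_k) + O(tau^2).  On the other
side, M^-1 (E(tau M) - I) = tau I + O(tau^2), while any convex combination of
G(t_k) and G(t_k + tau) is G(t_k) + O(tau).  The comparison of the two is
exponential_quadrature.

The expansion of M^-1 (E(tau M) - I) requires M to be invertible.  M is B,
diagonal with positive entries, times a discrete Laplacian K with nonnegative
off-diagonal entries.  The grid function w(x, y) = 2 - x^2 is positive on the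
square and K w < 0 at every node, even next to the boundary, where the
discarded boundary values of w are positive; this forces K to be injective by
a comparison argument (unitmx_supersolution, M_mx_unit).  *)

(** * Maximum norm of matrices *)

(** Joins the complete and the normed structures of matrices, so that the
absolute convergence criterion for series applies to them. *)
HB.instance Definition _ (R : realType) (m n : nat) :=
  Complete.on 'M[R]_(m, n).

Section MatrixNorm.
Context {R : realType}.

Lemma ler_entry_mx_norm m n (A : 'M[R]_(m, n)) i j : `|A i j| <= `|A|.
Proof.
by rewrite [leRHS]/Num.norm /= mx_normrE; apply/bigmax_geP; right; exists (i, j).
Qed.

Lemma mx_norm_le m n (A : 'M[R]_(m, n)) (c : R) : 0 <= c ->
  (forall i j, `|A i j| <= c) -> `|A| <= c.
Proof.
move=> c0 Ac; rewrite [leLHS]/Num.norm /= mx_normrE.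
by apply/bigmax_leP; split=> // -[i j] _.
Qed.

(** The maximum norm is not submultiplicative: the factor n counts the terms of
an entry of the product.  This is why n * |A| plays the role of the norm in the
bounds on powers and exponentials below. *)
Lemma mx_normM m n p (A : 'M[R]_(m, n)) (B : 'M[R]_(n, p)) :
  `|A *m B| <= n%:R * `|A| * `|B|.
Proof.
apply: mx_norm_le => [|i j]; first by rewrite !mulr_ge0.
rewrite mxE (le_trans (ler_norm_sum _ _ _))//.
apply: (@le_trans _ _ (\sum_(k < n) `|A| * `|B|)).
  by apply: ler_sum => k _; rewrite normrM ler_pM// ler_entry_mx_norm.
by rewrite sumr_const card_ord -mulrA mulr_natl.
Qed.

Lemma mx_norm_expr n (A : 'M[R]_n) k : `|A ^+ k| <= (n%:R * `|A|) ^+ k.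
Proof.
elim: k => [|k IH].
  apply: mx_norm_le => // i j; rewrite !expr0.
  by rewrite [X in `|X|]mxE; case: (i == j); rewrite ?normr1 ?normr0.
rewrite !exprS (le_trans (mx_normM _ _))//.
by rewrite ler_wpM2l// mulr_ge0.
Qed.

End MatrixNorm.

(** * The matrix exponential *)

Section MatrixExponential.
Context {R : realType}.

(** Proved directly because square matrices of arbitrary size, possibly 0, form
only a possibly trivial ring, whereas exprZn asks for an algebra over a
nontrivial one. *)
Lemma scalemx_expr n (r : R) (A : 'M[R]_n) k :
  (r *: A) ^+ k = r ^+ k *: A ^+ k.
Proof.
elim: k => [|k IH]; first by rewrite !expr0 scale1r.
rewrite !exprS IH; change (_ * _ = ?B) with ((r *: A) *m (r ^+ k *: A ^+ k) = B).
by rewrite -scalemxAl -scalemxAr scalerA.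
Qed.

(** The terms are dominated by those of the scalar exponential series at
n * |A|. *)
Lemma expmx_cvg n (A : 'M[R]_n) :
  series (fun k => (k`!%:R)^-1 *: A ^+ k) @ \oo --> expmx A.
Proof.
apply: normed_cvg.
apply: series_le_cvg (is_cvg_series_exp_coeff (n%:R * `|A|)) => k.
- exact: normr_ge0.
- by apply: exp_coeff_ge0; rewrite mulr_ge0.
rewrite /= normrZ ger0_norm ?invr_ge0// mulrC /exp_coeff/=.
by rewrite ler_wpM2r ?invr_ge0// mx_norm_expr.
Qed.

(** When c = n * |A| <= 1, each term of index k >= 2 is at most c^2 / k!, and
the sum of the 1 / k! is e. *)
Lemma expmx_rem2 n (A : 'M[R]_n) : n%:R * `|A| <= 1 ->
  `|expmx A - 1 - A| <= expR 1 * (n%:R * `|A|) ^+ 2.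
Proof.
set c := n%:R * _ => c1.
have c0 : 0 <= c by rewrite mulr_ge0.
pose u k : 'M[R]_n := (k`!%:R)^-1 *: A ^+ k.
have uA : series u k @[k --> \oo] --> expmx A by exact: expmx_cvg.
have cN : `|series u k - 1 - A| @[k --> \oo] --> `|expmx A - 1 - A|.
  by apply: cvg_norm; apply: cvgB; [apply: cvgB => //|]; exact: cvg_cst.
rewrite -(cvg_lim _ cN)//; apply: limr_le.
  by apply/cvg_ex; eexists; exact: cN.
near=> N.
have N2 : (2 <= N)%N by near: N; exact: nbhs_infty_ge.
rewrite /series/= (big_cat_nat _ (n := 2))//= big_ltn// big_nat1 /u.
rewrite fact0 expr0 invr1 !scale1r expr1.
rewrite (_ : 1 + A + _ - 1 - A = \sum_(2 <= i < N) u i); last first.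
  by rewrite [X in X - 1 - A]addrC -addrA -opprD addrK.
apply: (le_trans (ler_norm_sum _ _ _)).
apply: (@le_trans _ _ (\sum_(2 <= k < N) exp_coeff 1 k * c ^+ 2)).
  rewrite !big_nat; apply: ler_sum => k /andP[k2 _].
  rewrite /u normrZ ger0_norm ?invr_ge0// /exp_coeff/= expr1n mul1r.
  rewrite ler_wpM2l ?invr_ge0//; apply: (le_trans (mx_norm_expr _ _)).
  by rewrite ler_wiXn2l.
rewrite -mulr_suml ler_wpM2r ?exprn_ge0//.
apply: (@le_trans _ _ (series (exp_coeff 1) N)).
  rewrite /series/= [leRHS](big_cat_nat _ (n := 2))//= lerDr sumr_ge0// => i _.
  exact: exp_coeff_ge0.
apply: nondecreasing_cvgn_le; last exact: is_cvg_series_exp_coeff.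
by apply: nondecreasing_series => i _ _; exact: exp_coeff_ge0.
Unshelve. all: by end_near. Qed.

(** A pointwise limit of polynomials in r. *)
Lemma measurable_expmxZ n (A : 'M[R]_n) i j :
  measurable_fun [set: R] (fun r : R => expmx (r *: A) i j).
Proof.
apply: (@measurable_fun_cvg _ _ _ _
  (fun N (r : R) => series (fun k => (k`!%:R)^-1 *: (r *: A) ^+ k) N i j)).
  move=> N; rewrite [X in measurable_fun _ X](_ : _ =
     fun r => \sum_(0 <= k < N) r ^+ k * ((k`!%:R)^-1 * (A ^+ k) i j)).
    apply: measurable_sum => k.
    by apply: measurable_funM => //; exact: exprn_measurable.
  apply/funext => r; rewrite /series/= summxE; apply: eq_bigr => k _.
  by rewrite scalemx_expr !mxE; ring.
move=> r _; apply: (cvg_comp _ (fun B : 'M[R]_n => B i j)).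
  exact: expmx_cvg.
exact: coord_continuous.
Qed.
End MatrixExponential.

(** * Calm functions *)

Section Calm.
Context {R : realType}.

(** Calmness in the sense of variational analysis: a Lipschitz condition in
which one of the two points stays fixed at x. *)
Definition calm {V : normedModType R} (A : set R) (f : R -> V) (x : R) : Prop :=
  exists2 C : R, 0 <= C &
    \forall y \near within A (nbhs x), `|f y - f x| <= C * `|y - x|.

(** Near x the difference quotients are within 1 of their limit l, hence bounded
by |l| + 1. *)
Lemma derivable_within_calm (V : normedModType R) (A : set R) (f : R -> V) x :
  derivable_within A f x -> calm A f x.
Proof.
move=> /cvg_ex[l fl]; exists (`|l| + 1); first by rewrite addr_ge0.
move: fl => /cvgrPdist_lt /(_ 1 ltr01).
rewrite /dnbhs !near_withinE => nlF; apply: filterS nlF => y nl Ay.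
have [->|yx] := eqVneq y x; first by rewrite !subrr !normr0 mulr0.
have yx0 : y - x != 0 by rewrite subr_eq0.
have lq := nl yx Ay.
have -> : `|f y - f x| = `|(y - x)^-1 *: (f y - f x)| * `|y - x|.
  by rewrite normrZ normfV mulrAC mulVf ?mul1r// normr_eq0.
rewrite ler_wpM2r//.
rewrite -lerBlDl; apply: le_trans (ltW lq); rewrite distrC.
exact: lerB_dist.
Qed.

Lemma calm_cvg (V : normedModType R) (A : set R) (f : R -> V) x :
  calm A f x -> f y @[y --> within A (nbhs x)] --> f x.
Proof.
move=> [C C0 fC]; apply/cvgrPdist_le => e e0.
have C1 : 0 < C + 1 by rewrite ltr_pwDr.
have : \forall y \near within A (nbhs x), `|y - x| <= e / (C + 1).
  have : \forall y \near x, `|y - x| <= e / (C + 1).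
    near=> y; rewrite distrC ltW//; near: y.
    by apply: cvgr_dist_lt; [exact: cvg_id|rewrite divr_gt0].
  by rewrite near_withinE; apply: filterS.
apply: filterS2 fC => y fy yx; rewrite distrC (le_trans fy)//.
apply: (@le_trans _ _ ((C + 1) * (e / (C + 1)))).
  by apply: ler_pM => //; rewrite lerDl.
by rewrite mulrC divfK// gt_eqF.
Unshelve. all: by end_near. Qed.

Lemma calm_comp (A B : set R) (h w : R -> R) x :
  (forall y, A y -> B (w y)) -> calm A w x -> calm B h (w x) ->
  calm A (h \o w) x.
Proof.
move=> AB cw; have cvw := calm_cvg cw; case: cw => C C0 wC [D D0 hD].
exists (D * C); first exact: mulr_ge0.
rewrite near_withinE in hD.
have H : \forall y \near within A (nbhs x),
    B (w y) -> `|h (w y) - h (w x)| <= D * `|w y - w x| := cvw _ hD.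
rewrite !near_withinE in wC H *; apply: filterS2 wC H => y wy hy Ay.
rewrite -mulrA (le_trans (hy Ay (AB _ Ay)))// ler_wpM2l//; exact: wy.
Qed.

Lemma calm_entry m n (A : set R) (f : R -> 'M[R]_(m, n)) x i j :
  calm A f x -> calm A (fun s => f s i j) x.
Proof.
move=> [C C0 fC]; exists C => //; apply: filterS fC => y; apply: le_trans.
by have := ler_entry_mx_norm (f y - f x) i j; rewrite !mxE.
Qed.

Lemma calm_mx m n (A : set R) (f : R -> 'M[R]_(m, n)) x :
  (forall i j, calm A (fun s => f s i j) x) -> calm A f x.
Proof.
move=> cf.
have /choice[C /all_and2[C0 fC]] : forall ij : 'I_m * 'I_n, exists C : R, 0 <= C /\
    \forall y \near within A (nbhs x),
      `|f y ij.1 ij.2 - f x ij.1 ij.2| <= C * `|y - x|.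
  by move=> [i j]; have [C] := cf i j; exists C.
exists (\sum_ij C ij); first exact: sumr_ge0.
have fA : \forall y \near within A (nbhs x), forall ij : 'I_m * 'I_n,
    `|f y ij.1 ij.2 - f x ij.1 ij.2| <= C ij * `|y - x|.
  exact: filter_forall.
apply: filterS fA => y fy.
apply: mx_norm_le => [|i j]; first by rewrite mulr_ge0// sumr_ge0.
rewrite !mxE (le_trans (fy (i, j)))// ler_wpM2r//.
by rewrite (bigD1 (i, j))//= lerDl sumr_ge0.
Qed.

Lemma calm_mulr (A : set R) (f : R -> R) (c : R) x :
  calm A f x -> calm A (fun s => f s * c) x.
Proof.
move=> [C C0 fC]; exists (C * `|c|); first by rewrite mulr_ge0.
apply: filterS fC => y fy.
by rewrite -mulrBl normrM mulrAC ler_wpM2r.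
Qed.

End Calm.

(** * Invertibility of the discrete operator *)

Section Invertibility.
Context {R : realType}.

(** Generalized diagonal dominance, a discrete form of the maximum principle.
If A v = 0, let k maximize |v_k| / w_k and let q be the maximum.  Off the
diagonal A is nonnegative, so row k gives
|A_kk| q w_k <= q * sum_(l != k) A_kl w_l, while the k-th entry of A w being
negative says that the last sum is smaller than |A_kk| w_k; so q = 0. *)
Lemma unitmx_supersolution n (A : 'M[R]_n) (w : 'cV[R]_n) :
  (forall k l, k != l -> 0 <= A k l) -> (forall k, 0 < w k ord0) ->
  (forall k, (A *m w) k ord0 < 0) -> A \in unitmx.
Proof.
move=> A0 w0 Aw; rewrite -unitmx_tr -row_free_unit; apply: inj_row_free => u.
move=> /(congr1 trmx); rewrite trmx_mul trmxK trmx0.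
set v := u^T => Av; suff v0 : v = 0 by rewrite -[u]trmxK -/v v0 trmx0.
apply/matrixP => i j; rewrite (ord1 j) {j} [RHS]mxE.
pose q k := `|v k ord0| / w k ord0.
have [k _ kmax] := @arg_maxP _ R _ i xpredT q isT.
have [q0|qn0] := eqVneq (q k) 0.
  have : q i <= 0 by rewrite -q0; exact: kmax.
  by rewrite /q pmulr_lle0 ?invr_gt0// normr_le0 => /eqP.
have qk0 : 0 < q k by rewrite lt_neqAle eq_sym qn0/= /q divr_ge0// ltW.
have vq l : `|v l ord0| <= q k * w l ord0.
  by rewrite -ler_pdivrMr//; exact: kmax.
have vk : `|v k ord0| = q k * w k ord0 by rewrite /q divfK// gt_eqF.
have Ak : A k k * w k ord0 + \sum_(l | l != k) A k l * w l ord0 < 0.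
  by have := Aw k; rewrite mxE (bigD1 k).
have Avk : A k k * v k ord0 + \sum_(l | l != k) A k l * v l ord0 = 0.
  by have /matrixP/(_ k ord0) := Av; rewrite [LHS]mxE [RHS]mxE (bigD1 k).
have S0 : 0 <= \sum_(l | l != k) A k l * w l ord0.
  by apply: sumr_ge0 => l lk; rewrite mulr_ge0 ?A0 1?eq_sym// ltW.
have Akk : A k k < 0.
  have : A k k * w k ord0 < 0 by lra.
  by rewrite pmulr_llt0.
have H1 : `|A k k * v k ord0| <= q k * \sum_(l | l != k) A k l * w l ord0.
  rewrite (_ : A k k * v k ord0 = - \sum_(l | l != k) A k l * v l ord0); last first.
    by apply/eqP; rewrite -addr_eq0 Avk.
  rewrite normrN (le_trans (ler_norm_sum _ _ _))// mulr_sumr.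
  apply: ler_sum => l lk; rewrite normrM ger0_norm ?A0 1?eq_sym//.
  by rewrite mulrCA ler_wpM2l ?A0 1?eq_sym.
move: H1; rewrite normrM vk ltr0_norm// mulrCA ler_pM2l// mulNr; lra.
Qed.

Lemma mesh_lt N (z : nat -> R) i j : is_mesh N z ->
  (i < j <= N.+1)%N -> z i < z j.
Proof.
move=> [_ _ zS] /andP[]; elim: j => // j IH; rewrite ltnS leq_eqVlt.
move=> /orP[/eqP-> jN|ij jN]; first exact: zS.
by apply: (lt_trans (IH ij (ltnW jN))); exact: zS.
Qed.

Lemma mesh_bounds N (z : nat -> R) (i : 'I_N) : is_mesh N z ->
  -1 < z i.+1 < 1.
Proof.
move=> zN; have [z0 z1 _] := zN; rewrite -{1}z0 -z1.
by rewrite (mesh_lt zN)//= ?(mesh_lt zN)//= !ltnS ?leqnn ?ltn_ord// ltnW.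
Qed.

Lemma mesh_step_gt0 N (z : nat -> R) i : is_mesh N z -> (i <= N)%N ->
  0 < mesh_step z i.
Proof. by move=> [_ _ zS] iN; rewrite subr_gt0; exact: zS. Qed.

(** The divided second difference is exact on quadratics, so the three-point
stencil maps c - d z^2 to -2 d.  Next to the boundary T_mx drops the stencil
entry at the endpoint -1 or 1; there the quadratic equals c - d >= 0, so
dropping it can only decrease the value. *)
Lemma T_mx_quadratic N (z : nat -> R) (c d : R) (i : 'I_N) : is_mesh N z ->
  d <= c ->
  (T_mx N z *m \col_(j < N) (c - d * z j.+1 ^+ 2)) i ord0 <= - (2 * d).
Proof.
move=> zN dc; have [z0 z1 _] := zN.
pose h := mesh_step z; pose phi q := c - d * z q ^+ 2.
have h0 q : (q <= N)%N -> 0 < h q by exact: mesh_step_gt0.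
have hge q : (q <= N)%N -> 0 <= h q by move=> /h0/ltW.
have iN := ltn_ord i.
rewrite mxE (eq_bigr (fun j : 'I_N => T_entry h i.+1 j.+1 * phi j.+1)); last first.
  by move=> j _; rewrite !mxE.
rewrite -(big_mkord xpredT (fun j => T_entry h i.+1 j.+1 * phi j.+1)).
rewrite -(big_add1 _ _ 0 N.+1 xpredT (fun q => T_entry h i.+1 q * phi q)).
have phi0 : phi 0%N = c - d by rewrite /phi z0; ring.
have phi1 : phi N.+1 = c - d by rewrite /phi z1; ring.
have T0 : 0 <= T_entry h i.+1 0.
  rewrite /T_entry/=; case: eqP => // i0; apply: divr_ge0 => //.
  by apply: mulr_ge0; [|apply: addr_ge0]; apply: hge; lia.
have TN : 0 <= T_entry h i.+1 N.+1.
  rewrite /T_entry; case: eqP => [|_]; first lia.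
  case: eqP => [_|_]; last by case: eqP => //; lia.
  apply: divr_ge0 => //.
  by apply: mulr_ge0; [|apply: addr_ge0]; apply: hge; lia.
(* Restore the two boundary terms, of index 0 and N + 1. *)
apply: (@le_trans _ _ (\sum_(0 <= q < N.+2) T_entry h i.+1 q * phi q)).
  rewrite [leRHS]big_ltn// [X in _ <= _ + X]big_nat_recr//= phi0 phi1.
  by rewrite addrCA lerDl addr_ge0// mulr_ge0// subr_ge0.
(* With p = i + 1, only the terms of index p - 1, p, p + 1 are nonzero. *)
rewrite (big_cat_nat _ (n := i))//=; last lia.
rewrite big_nat big1 ?add0r => [|q qi]; last first.
  by rewrite /T_entry; do ![case: eqP => [|_]; first lia]; rewrite mul0r.
rewrite big_ltn; last lia.
rewrite big_ltn; last lia.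
rewrite big_ltn; last lia.
rewrite big_nat big1 ?addr0 => [|q qi]; last first.
  by rewrite /T_entry; do ![case: eqP => [|_]; first lia]; rewrite mul0r.
have -> : T_entry h i.+1 i = 2 / (h i * (h i + h i.+1)).
  by rewrite /T_entry; do 2![case: eqP => [|_]; first lia]; rewrite eqxx.
have -> : T_entry h i.+1 i.+1 = - (2 / (h i * h i.+1)).
  by rewrite /T_entry eqxx.
have -> : T_entry h i.+1 i.+2 = 2 / (h i.+1 * (h i + h i.+1)).
  by rewrite /T_entry; case: eqP => [|_]; first lia; rewrite eqxx.
have hi := h0 i (ltnW iN); have hi1 := h0 _ iN.
have z1E : z i.+1 = z i + h i by rewrite /h /mesh_step; ring.
have z2E : z i.+2 = z i + h i + h i.+1 by rewrite -z1E /h /mesh_step; ring.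
rewrite /phi z2E z1E le_eqVlt; apply/orP; left; apply/eqP; field.
by rewrite !gt_eqF// addr_gt0.
Qed.

Lemma T_entry_ge0 N (z : nat -> R) (i j : 'I_N) : is_mesh N z -> i != j ->
  0 <= T_mx N z i j.
Proof.
move=> zN ij; rewrite mxE /T_entry eqSS.
have h0 q : (q <= N)%N -> 0 <= mesh_step z q by move=> /(mesh_step_gt0 zN)/ltW.
have /negbTE -> : (j : nat) != i by rewrite eq_sym.
have iN := ltn_ord i; have jN := ltn_ord j.
have q0 p q r : (p <= N)%N -> (q <= N)%N -> (r <= N)%N ->
    0 <= 2 / (mesh_step z p * (mesh_step z q + mesh_step z r)).
  move=> *; apply: divr_ge0 => //.
  by apply: mulr_ge0; [|apply: addr_ge0]; exact: h0.
case: eqP => _; first by apply: q0; lia.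
by case: eqP => // ?; apply: q0; lia.
Qed.

Lemma domD_node Nx Ny (x y : nat -> R) (k : 'I_(Ny * Nx)) :
  is_mesh Nx x -> is_mesh Ny y -> domD (node x y k).
Proof. by move=> xN yN; split; exact: mesh_bounds. Qed.

Lemma open_domD : open (@domD R).
Proof.
pose I : set R := `]-1, 1[%classic.
have I0 : open I by exact: interval_open.
rewrite (_ : domD = fst @^-1` I `&` snd @^-1` I); last first.
  by apply/seteqP; split=> -[p q]; rewrite /domD /I /= !in_itv.
by apply: openI; apply: open_comp => // z _; [exact: cvg_fst|exact: cvg_snd].
Qed.

Lemma degeneracy_gt0 (sigma : R * R -> R) p : degeneracy sigma ->
  domD p -> 0 < sigma p.
Proof.
move=> [s0 s1] Dp; have cp : closure domD p by exact: subset_closure.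
rewrite lt_neqAle s0// andbT; apply/eqP => /esym/(s1 _ cp)[_]; apply.
by rewrite (interior_id _).1//; exact: open_domD.
Qed.

(** The supersolution is 2 - x^2: the part of the operator in the x-direction
sends it to values at most -2, and the part in the y-direction, in which it is
constant, to values at most 0. *)
Lemma M_mx_unit Nx Ny (a b : R) (x y : nat -> R) (sigma : R * R -> R) :
  0 < a -> 0 < b -> is_mesh Nx x -> is_mesh Ny y -> degeneracy sigma ->
  M_mx Nx Ny a b x y sigma \in unitmx.
Proof.
move=> a0 b0 xN yN sP; rewrite /M_mx !scalemxAr -mulmxDr unitmx_mul.
apply/andP; split.
  rewrite unitmxE det_diag unitfE; apply/prodf_neq0 => k _.
  by rewrite mxE invr_neq0// gt_eqF// degeneracy_gt0//; exact: domD_node.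
(* Both factors have the form c - d z^2 that T_mx_quadratic expects. *)
pose one : 'cV[R]_Ny := \col_(j < Ny) (1 - 0 * y j.+1 ^+ 2).
pose w : 'cV[R]_Nx := \col_(i < Nx) (2 - 1 * x i.+1 ^+ 2).
have w0 i j : 0 < w i j.
  by rewrite mxE; have /andP[] := mesh_bounds i xN; nra.
pose W : 'cV[R]_(Ny * Nx) := one *t w.
(* tensmx_mul yields a matrix with 1 * 1 columns, whose column indices are
   identified with ord0 here. *)
have tensW (A : 'M[R]_Ny) (C : 'M[R]_Nx) (k : 'I_(Ny * Nx)) :
    ((A *t C) *m W) k ord0 =
    (A *m one) (mxtens_unindex k).1 ord0 * (C *m w) (mxtens_unindex k).2 ord0.
  have /matrixP/(_ k ord0) -> := tensmx_mul A C one w.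
  by rewrite mxE; congr (_ * _); congr (fun_of_matrix _ _ _); exact: ord1.
apply: (@unitmx_supersolution _ _ W).
- move=> k l; case: (mxtens_indexP k) => j i; case: (mxtens_indexP l) => j' i'.
  rewrite (can_eq (@mxtens_indexK _ _)) xpair_eqE negb_and => ji.
  rewrite mxE [X in X + _]mxE [X in _ + X]mxE !tensmxE.
  apply: addr_ge0; (apply: mulr_ge0; first by rewrite invr_ge0 exprn_ge0// ltW).
  + rewrite mxE; case: eqVneq ji => [_ /= ii|_ _]; last by rewrite mul0r.
    by rewrite mul1r; exact: T_entry_ge0 xN ii.
  + rewrite [X in _ * X]mxE; case: (eqVneq i i') ji => [_|_ _]; last first.
      by rewrite mulr0.
    by rewrite orbF mulr1; exact: T_entry_ge0 yN.
- move=> k; rewrite mxE; apply: mulr_gt0; last exact: w0.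
  by rewrite mxE mul0r subr0.
- move=> k; rewrite mulmxDl -!scalemxAl mxE [X in X + _]mxE [X in _ + X]mxE.
  rewrite !tensW !mul1mx; set j := (_ k).1; set i := (_ k).2.
  have T1 : (T_mx Nx x *m w) i ord0 <= - (2 * 1).
    by apply: T_mx_quadratic => //; lra.
  have T2 : (T_mx Ny y *m one) j ord0 <= - (2 * 0).
    by apply: T_mx_quadratic => //; lra.
  have a2 : 0 < a ^- 2 by rewrite invr_gt0 exprn_gt0.
  have b2 : 0 <= b ^- 2 by rewrite invr_ge0 exprn_ge0// ltW.
  rewrite (_ : one j ord0 = 1) ?mul1r; last by rewrite mxE mul0r subr0.
  rewrite -[ltRHS](addr0 0) ltr_leD//; first by rewrite pmulr_rlt0//; lra.
  by rewrite mulr_ge0_le0// mulr_le0_ge0//; [lra|exact: ltW].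
Qed.

End Invertibility.

(** * The local error of the exponential quadrature *)

Section Quadrature.
Context {R : realType}.

(** The threshold 1 / (1 + n * |A|) keeps n * |r A| <= 1, as expmx_rem2
requires. *)
Lemma expmxZ_taylor n (A : 'M[R]_n) :
  exists C d : R, [/\ 0 <= C, 0 < d &
    forall r, 0 <= r <= d -> `|expmx (r *: A) - 1 - r *: A| <= C * r ^+ 2].
Proof.
pose c := n%:R * `|A|; have c0 : 0 <= c by rewrite mulr_ge0.
exists (expR 1 * c ^+ 2), (1 + c)^-1; split.
- by rewrite mulr_ge0 ?expR_ge0 ?exprn_ge0.
- by rewrite invr_gt0 ltr_pwDl.
move=> r /andP[r0 rd].
have rcE : n%:R * `|r *: A| = c * r by rewrite normrZ ger0_norm// /c; ring.
have rc1 : n%:R * `|r *: A| <= 1.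
  rewrite rcE (@le_trans _ _ ((1 + c) * (1 + c)^-1))//.
    by rewrite ler_pM// lerDr.
  by rewrite mulfV// gt_eqF// ltr_pwDl.
by rewrite (le_trans (expmx_rem2 rc1))// rcE exprMn mulrA.
Qed.

Lemma integral_near_cst (F : R -> R) (c e t u : R) :
  t <= u -> measurable_fun `[t, u] F ->
  (forall s, t <= s <= u -> `|F s - c| <= e) ->
  `|\int[lebesgue_measure]_(s in `[t, u]) F s - (u - t) * c| <= (u - t) * e.
Proof.
move=> tu mF Fc.
have mI : measurable (`[t, u]%classic : set R) by exact: measurable_itv.
have muI : lebesgue_measure (`[t, u]%classic : set R) = (u - t)%:E.
  rewrite lebesgue_measure_itv/= lte_fin.
  by case: ltgtP tu => // -> _; rewrite subrr.
have fI : (lebesgue_measure (`[t, u]%classic : set R) < +oo)%E by rewrite muI ltry.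
have bI (H : R -> R) (K : R) : measurable_fun `[t, u] H ->
    (forall s, t <= s <= u -> `|H s| <= K) ->
    lebesgue_measure.-integrable `[t, u] (EFin \o H).
  move=> mH HK; apply: measurable_bounded_integrable => //.
  exists K; split=> [|M KM s]; first exact: num_real.
  by rewrite /= in_itv/= => /HK Hs; exact: le_trans (ltW KM).
have ic (k : R) : lebesgue_measure.-integrable `[t, u] (EFin \o (fun=> k)).
  exact: (bI _ `|k|).
have iF : lebesgue_measure.-integrable `[t, u] (EFin \o F).
  apply: (bI _ (e + `|c|)) => // s /Fc Fs.
  by rewrite -lerBlDr (le_trans _ Fs)// lerB_dist.
have mFc : measurable_fun `[t, u] (fun s => F s - c) by exact: measurable_funB.
have iFc : lebesgue_measure.-integrable `[t, u] (EFin \o (fun s => F s - c)).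
  exact: (bI _ e).
have iFcn : lebesgue_measure.-integrable `[t, u] (EFin \o (fun s => `|F s - c|)).
  by apply: (bI _ e) => [|s /Fc]; [exact: measurableT_comp|rewrite normr_id].
have intc k : \int[lebesgue_measure]_(s in `[t, u]) k = (u - t) * k.
  by rewrite Rintegral_cst// mulrC; congr (_ * _); exact: (congr1 fine muI).
rewrite -!intc -RintegralB//.
apply: le_trans; first exact: le_normr_Rintegral.
by apply: le_Rintegral => // s; rewrite /= in_itv/=; exact: Fc.
Qed.

(** Each of the two terms is compared with tau * G t: for the integral, by
E((t + tau - s) M) G(s) - G(t) = (E((t + tau - s) M) - I) G(s) + (G(s) - G(t)),
and for the other, with W the convex combination of G(t) and G(t + tau), by
M^-1 (E(tau M) - I) W - tau G(t)
  = M^-1 (E(tau M) - I - tau M) W + tau (W - G(t)). *)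
Lemma exponential_quadrature n (M : 'M[R]_n) (G : R -> 'cV[R]_n)
    (t L d theta : R) :
  M \in unitmx -> 0 <= L -> 0 < d -> 0 <= theta <= 1 ->
  (forall k, measurable_fun `[t, t + d] (fun s => G s k ord0)) ->
  (forall s, t <= s <= t + d -> `|G s - G t| <= L * (s - t)) ->
  exists C d', [/\ 0 <= C, 0 < d' & forall tau, 0 < tau <= d' ->
    `|integral_cV t (t + tau) (fun s => expmx ((t + tau - s) *: M) *m G s)
      - invmx M *m (expmx (tau *: M) - 1%:M)
          *m (theta *: G t + (1 - theta) *: G (t + tau))| <= C * tau ^+ 2].
Proof.
move=> Mu L0 d0 /andP[th0 th1] mG GL.
have [C [e [C0 e0 MC]]] := expmxZ_taylor M.
pose N : R := n%:R.
pose c1 := C + `|M|; pose B := `|G t| + L.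
pose c3 := N * c1 * B + L; pose c4 := N * (N * `|invmx M| * C) * B + L.
have N0 : 0 <= N by [].
have c10 : 0 <= c1 by rewrite addr_ge0.
have B0 : 0 <= B by rewrite addr_ge0.
have c30 : 0 <= c3 by rewrite addr_ge0// !mulr_ge0.
have c40 : 0 <= c4 by rewrite addr_ge0// !mulr_ge0.
exists (c3 + c4), (Num.min 1 (Num.min d e)); split; first exact: addr_ge0.
  by rewrite !lt_min ltr01 d0 e0.
move=> tau /andP[tau0]; rewrite !le_min => /and3P[tau1 taud taue].
have tau0' := ltW tau0.
(* B bounds G on the whole step, since L * tau <= L. *)
have GB s : t <= s <= t + tau -> `|G s - G t| <= L * tau.
  move=> sI; apply: (le_trans (GL s _)); first lra.
  by rewrite ler_wpM2l//; lra.
have GB' s : t <= s <= t + tau -> `|G s| <= B.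
  move=> /GB Gs; rewrite -lerBlDl (le_trans (lerB_dist _ _))//.
  by rewrite (le_trans Gs)// ler_piMr.
have E1 r : 0 <= r <= tau -> `|expmx (r *: M) - 1| <= c1 * tau.
  move=> /andP[r0 rt].
  rewrite -(subrK (r *: M) (_ - 1)) (le_trans (ler_normD _ _))//.
  rewrite /c1 mulrDl lerD//; last first.
    by rewrite normrZ ger0_norm// mulrC ler_wpM2l.
  apply: (le_trans (MC _ _)); first lra.
  rewrite ler_wpM2l//; nra.
set J := integral_cV _ _ _.
set Q := _ *m (_ + _).
have HJ : `|J - tau *: G t| <= c3 * tau ^+ 2.
  apply: mx_norm_le => [|k j]; first by rewrite mulr_ge0 ?exprn_ge0.
  rewrite (ord1 j) {j} !mxE.
  have tE : t + tau - t = tau by ring.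
  have -> : c3 * tau ^+ 2 = tau * (c3 * tau) by ring.
  have := @integral_near_cst
    (fun s => (expmx ((t + tau - s) *: M) *m G s) k ord0)
    (G t k ord0) (c3 * tau) t (t + tau).
  rewrite tE; apply.
  - by rewrite lerDl.
  - rewrite [X in measurable_fun _ X](_ : _ = fun s =>
      \sum_l expmx ((t + tau - s) *: M) k l * G s l ord0); last first.
      by apply/funext => s; rewrite mxE.
    apply: measurable_sum => l; apply: measurable_funM.
      apply: measurable_funTS.
      apply: (measurableT_comp (measurable_expmxZ M k l)).
      exact: measurable_funB.
    apply: measurable_funS (mG l) => // s; rewrite /= !in_itv/= => /andP[-> /=].
    by move=> st; rewrite (le_trans st)// lerD2l.
  - move=> s sI.
    have -> : (expmx ((t + tau - s) *: M) *m G s) k ord0 - G t k ord0 =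
        ((expmx ((t + tau - s) *: M) - 1) *m G s + (G s - G t)) k ord0.
      by rewrite mulmxBl mul1mx addrA subrK !mxE.
    apply: (le_trans (ler_entry_mx_norm _ _ _)).
    apply: (le_trans (ler_normD _ _)); rewrite /c3 mulrDl lerD ?GB//.
    apply: (le_trans (mx_normM _ _)).
    rewrite [leRHS](_ : _ = N * (c1 * tau) * B); last by ring.
    rewrite ler_pM ?GB'// ?mulr_ge0// ler_wpM2l//; apply: E1; lra.
have HQ : `|Q - tau *: G t| <= c4 * tau ^+ 2.
  pose W := theta *: G t + (1 - theta) *: G (t + tau).
  pose D := expmx (tau *: M) - 1 - tau *: M.
  have tI : t <= t + tau <= t + tau by rewrite lerDl lexx tau0'.
  have WE : W - G t = (1 - theta) *: (G (t + tau) - G t).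
    by apply/matrixP => i j; rewrite !mxE; ring.
  have WL : `|W - G t| <= L * tau.
    rewrite WE normrZ ger0_norm ?subr_ge0//.
    apply: (@le_trans _ _ (1 * `|G (t + tau) - G t|)).
      by rewrite ler_wpM2r//; lra.
    by rewrite mul1r GB.
  have WB : `|W| <= B.
    rewrite -lerBlDl (le_trans (lerB_dist _ _))//.
    by rewrite (le_trans WL)// ler_piMr.
  have -> : Q - tau *: G t = (invmx M *m D) *m W + tau *: (W - G t).
    have -> : D = (expmx (tau *: M) - 1%:M) - tau *: M by [].
    rewrite mulmxBr -scalemxAr mulVmx// mulmxBl -scalemxAl mul1mx scalerBr.
    by rewrite addrA subrK.
  apply: (le_trans (ler_normD _ _)); rewrite /c4 mulrDl lerD//; last first.
    rewrite normrZ ger0_norm// expr2 mulrA [leRHS]mulrC.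
    by rewrite ler_wpM2l.
  apply: (le_trans (mx_normM _ _)).
  rewrite [leRHS](_ : _ = N * (N * `|invmx M| * (C * tau ^+ 2)) * B); last by ring.
  rewrite ler_pM ?mulr_ge0//; rewrite ler_wpM2l//.
  apply: (le_trans (mx_normM _ _)); rewrite ler_wpM2l ?mulr_ge0//.
  by apply: MC; rewrite tau0' taue.
have -> : J - Q = (J - tau *: G t) - (Q - tau *: G t) by rewrite opprB addrA subrK.
by rewrite mulrDl (le_trans (ler_normB _ _))// lerD.
Qed.

End Quadrature.

(** * The truncation error *)

Theorem lemma2p1 (R : realType) (Nx Ny : nat) (a b : R) (x y : nat -> R)
    (sigma eps : R * R -> R) (f : R -> R -> R)
    (I : interval R) (v : R -> 'cV[R]_(Ny * Nx)) (tk delta theta : R)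
    (Nx_gt0 : (0 < Nx)%N) (Ny_gt0 : (0 < Ny)%N) (a_gt0 : 0 < a) (b_gt0 : 0 < b)
    (x_mesh : is_mesh Nx x) (y_mesh : is_mesh Ny y)
    (sigmaP : degeneracy sigma)
    (eps_bounded : [bounded eps p | p in domD])
    (f_reaction : forall p, domD p -> reaction_term (f (eps p)))
    (f_C2 : forall p, domD p -> C2_within `[0, 1[ (f (eps p)))
    (v_solution :
       is_ode_solution I (M_mx Nx Ny a b x y sigma) (g_vec x y sigma eps f) v)
    (v_range : forall t k, t \in I -> v t k ord0 \in `[0, 1[)
    (tk_in : tk \in I) (delta_gt0 : 0 < delta) (tk_delta_in : tk + delta \in I)
    (theta_ge0 : 0 <= theta) (theta_le1 : theta <= 1) :
  let M := M_mx Nx Ny a b x y sigma in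
  let g := g_vec x y sigma eps f in
  let p := (if theta == 2^-1 then 2 else 1)%N in
  (fun tau : R =>
     integral_cV tk (tk + tau)
       (fun s => expmx ((tk + tau - s) *: M) *m g (v s))
     - invmx M *m (expmx (tau *: M) - 1%:M)
         *m (theta *: g (v tk) + (1 - theta) *: g (v (tk + tau))))
  =O_ (0^'+) (fun tau : R => tau ^+ p).
Proof.
move=> M g p.
have g_calm t : t \in I -> calm [set` I] (g \o v) t.
  move=> tI; have v_calm : calm [set` I] v t.
    by apply: derivable_within_calm; have [] := v_solution t tI.
  apply: calm_mx => k j; rewrite (ord1 j) {j}.
  have -> : (fun s => (g \o v) s k ord0) = fun s =>
      (f (eps (node x y k)) \o (fun s => v s k ord0)) s / sigma (node x y k).
    by apply/funext => s; rewrite /= mxE.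
  apply: calm_mulr; apply: (@calm_comp _ _ `[0, 1[%classic).
  - by move=> s sI; rewrite /=; exact: v_range.
  - exact: calm_entry.
  - apply: derivable_within_calm.
    have [_ f_der _ _] := f_reaction _ (domD_node k x_mesh y_mesh).
    by have [] := f_der _ (v_range t k tI).
have subI s : tk <= s <= tk + delta -> s \in I.
  exact: (@interval_is_interval _ I _ _ tk_in tk_delta_in).
have [L L0 gL] := g_calm tk tk_in.
(* The bound holds on a ball of radius r around t_k; halving r keeps the closed
   interval [t_k, t_k + d] inside that ball. *)
move: gL; rewrite near_withinE => /nbhs_ballP[r /= r0 gL].
pose d := Num.min delta (r / 2).
have d0 : 0 < d by rewrite lt_min delta_gt0 divr_gt0.
have ddelta : d <= delta by rewrite ge_min lexx.
have dr : d <= r / 2 by rewrite ge_min lexx orbT.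
have [||||C [e [C0 e0 CP]]] :=
  @exponential_quadrature _ _ M (g \o v) tk L d theta _ L0 d0.
- exact: M_mx_unit.
- by rewrite theta_ge0.
- move=> k; apply: subspace_continuous_measurable_fun => //.
  apply/subspace_continuousP => s; rewrite /= in_itv/= => sd.
  have sI : s \in I by apply: subI; lra.
  have := calm_cvg (calm_entry k ord0 (g_calm s sI)).
  apply: cvg_trans; apply: cvg_app; apply: within_subset => z /=.
  by rewrite in_itv/= => zd; apply: subI; lra.
- move=> s sd; have := gL s; rewrite [`|s - tk|]ger0_norm ?subr_ge0; last lra.
  apply; last by apply: subI; lra.
  by rewrite /ball/= distrC ger0_norm ?subr_ge0; lra.
apply/eqO_exP; exists (C + 1); first by rewrite ltr_wpDl.
near=> tau.
have tau0 : 0 < tau by near: tau; exact: nbhs_right_gt.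
have tau1 : tau <= 1 by near: tau; exact: nbhs_right_le.
have taue : tau <= e by near: tau; exact: nbhs_right_le.
apply: (le_trans (CP tau _)); first by rewrite tau0.
rewrite normrX gtr0_norm//; apply: ler_pM => //.
- by rewrite exprn_ge0// ltW.
- by rewrite lerDl.
- by apply: ler_wiXn2l; rewrite ?ltW// /p; case: ifP.
Unshelve. all: by end_near. Qed.
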